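(* Let $X$ be a pointed metric space and let $E$ be a Banach space over $\mathbb{R}$. Let $X_0\subset X$ be a subset of $X$ containing $0$, and let $E_0$ be a closed linear subspace of $E$. Then $X_0\widehat{\boxtimes}_{\varepsilon}E_0$ is a linear subspace of $X\widehat{\boxtimes}_{\varepsilon}E$.
   Context: The scalar field is $\mathbb{R}$. A pointed metric space $X$ is a metric space with a distinguished base point, denoted $0$; $X_0$ carries the restricted metric and the same base point. For a pointed metric space $X$ and a Banach space $F$, $\mathrm{Lip}_0(X,F)$ is the Banach space of all Lipschitz maps $f\colon X\to F$ with $f(0)=0$, normed by the least Lipschitz constant $\mathrm{Lip}(f)$; $X^\#=\mathrm{Lip}_0(X,\mathbb{R})$. $B_Z$ denotes the closed unit ball of a normed space $Z$. $E^*$ is the topological dual of $E$ and $\langle\phi,e\rangle=\phi(e)$; $V'$ denotes the algebraic dual of a vector space $V$. For $x,y\in X$ and $e\in E$, $\delta_{(x,y)}\boxtimes e\in \mathrm{Lip}_0(X,E^* )'$ is the linear functional $f\mapsto\langle f(x)-f(y),e\rangle$. The Lipschitz tensor product $X\boxtimes E$ is the linear subspace of $\mathrm{Lip}_0(X,E^* )'$ spanned by all the functionals $\delta_{(x,y)}\boxtimes e$ with $x,y\in X$, $e\in E$. The Lipschitz injective norm on $X\boxtimes E$ is, for $u=\sum_{i=1}^n \delta_{(x_i,y_i)}\boxtimes e_i$ (independently of the representation), $$\varepsilon(u)=\sup\left\{\left|\sum_{i=1}^n(g(x_i)-g(y_i))\langle\phi,e_i\rangle\right|\colon g\in B_{X^\#},\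 \phi\in B_{E^*}\right\}.$$ $X\widehat{\boxtimes}_{\varepsilon}E$ (the injective Lipschitz tensor product of $X$ and $E$) is the completion of $X\boxtimes E$ with the norm $\varepsilon$; $X_0\widehat{\boxtimes}_{\varepsilon}E_0$ is defined in the same way from $X_0$ and $E_0$. *)

(* Defs.v *)
From HB Require Import structures.
From mathcomp Require Import all_boot all_order all_algebra.
From mathcomp Require Import all_classical all_reals.
From mathcomp Require Import topology normedtype.
From mathcomp Require Import lra.

Set Implicit Arguments.
Unset Strict Implicit.
Unset Printing Implicit Defensive.

Import Order.TTheory GRing.Theory Num.Theory.
Import numFieldNormedType.Exports.

Local Open Scope classical_set_scope.
Local Open Scope ring_scope.

(* The library already equips the subtype of a set [A] with the initial
   pseudometric; this adds the restricted distance. *)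
Section restricted_metric.
Context {R : realType} {X : metricType R} (A : set X).

Let dist (x y : A) : R := mdist (\val x) (\val y).

Let dist_ge0 x y : 0 <= dist x y.
Proof. exact: mdist_ge0. Qed.

Let dist_positivity x y : dist x y = 0 -> x = y.
Proof. by move=> /mdist_positivity/val_inj. Qed.

Let ballEdist x d : ball x d = [set y | dist x y < d].
Proof.
by rewrite -initial_ballE ballEmdist /dist set_valE.
Qed.

HB.instance Definition _ :=
  PseudoMetric_isMetric.Build R (A : Type) dist_ge0 dist_positivity ballEdist.

Definition restricted_point (o : X) (oA : A o) : A := exist _ o (mem_set oA).

End restricted_metric.

Section subspace_normed.
Context {R : realType} {E : normedModType R} (S : submodClosed E).

Record linear_subspace := LinearSubspace {
  linear_subspace_val :> E ;
  _ : linear_subspace_val \in S }.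

HB.instance Definition _ := [isSub for linear_subspace_val].
HB.instance Definition _ := [Choice of linear_subspace by <:].
HB.instance Definition _ := [SubChoice_isSubLmodule of linear_subspace by <:].

Let norm (x : linear_subspace) : R := `|val x|.

Let ler_normD x y : norm (x + y) <= norm x + norm y.
Proof. exact: ler_normD. Qed.

Let normrZ (a : R) x : norm (a *: x) = `|a| * norm x.
Proof. exact: normrZ. Qed.

Let normr0_eq0 x : norm x = 0 -> x = 0.
Proof. by move/normr0_eq0 => x0; exact/val_inj. Qed.

HB.instance Definition _ :=
  Lmodule_isNormed.Build R linear_subspace ler_normD normrZ normr0_eq0.

End subspace_normed.

Section algebraic_dual.
Context {R : realType} (V : lmodType R).

Definition is_linear_functional : {pred V -> R} :=
  fun f => `[< linear (f : V -> R) >].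

Fact is_linear_functional_submod : submod_closed is_linear_functional.
Proof.
split=> [|a f g].
  by apply/asboolP => k x y /=; rewrite scaler0 addr0.
move=> /asboolP fl /asboolP gl; apply/asboolP => k x y.
by rewrite !fctE /= fl gl !scalerDr !scalerA [k * a]mulrC addrACA.
Qed.
HB.instance Definition _ := GRing.isSubmodClosed.Build R (V -> R)
  is_linear_functional is_linear_functional_submod.

Record algdual := AlgDual {
  algdual_fun :> V -> R ;
  _ : algdual_fun \in is_linear_functional }.

HB.instance Definition _ := [isSub for algdual_fun].
HB.instance Definition _ := [Choice of algdual by <:].
HB.instance Definition _ := [SubChoice_isSubLmodule of algdual by <:].

End algebraic_dual.

Section dual.
Context {R : realType} (E : normedModType R).

Definition is_continuous_functional : {pred E -> R} :=
  fun f => `[< linear (f : E -> R) /\ continuous f >].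

Fact is_continuous_functional_submod : submod_closed is_continuous_functional.
Proof.
split=> [|a f g].
  apply/asboolP; split; first by move=> k x y /=; rewrite scaler0 addr0.
  by move=> x; exact: cvg_cst.
move=> /asboolP[fl fc] /asboolP[gl gc]; apply/asboolP; split.
  move=> k x y; rewrite !fctE /= fl gl !scalerDr !scalerA [k * a]mulrC.
  by rewrite addrACA.
by move=> x; apply: cvgD; [apply: cvgZl_tmp; exact: fc|exact: gc].
Qed.

HB.instance Definition _ := GRing.isSubmodClosed.Build R (E -> R)
  is_continuous_functional is_continuous_functional_submod.

Record dual := Dual {
  dual_fun :> E -> R ;
  _ : dual_fun \in is_continuous_functional }.

HB.instance Definition _ := [isSub for dual_fun].
HB.instance Definition _ := [Choice of dual by <:].
HB.instance Definition _ := [SubChoice_isSubLmodule of dual by <:].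

Lemma dual_linear (f : dual) : linear (f : E -> R).
Proof. by case: f => f /= /asboolP[]. Qed.

Lemma dual_continuous (f : dual) : continuous (f : E -> R).
Proof. by case: f => f /= /asboolP[]. Qed.

HB.instance Definition _ (f : dual) :=
  GRing.isLinear.Build R E R _ (dual_fun f) (@dual_linear f).

Lemma dualZ (f : dual) (a : R) (e : E) : f (a *: e) = a * f e.
Proof. exact: linearZ. Qed.

Let values (f : dual) : set R := [set `|f e| | e in [set e : E | `|e| <= 1]].
Let norm (f : dual) : R := sup (values f).

Let values_sup (f : dual) : has_sup (values f).
Proof.
split; first by exists `|f 0|, 0 => //=; rewrite normr0.
have /linear_boundedP := @continuous_linear_bounded _ _ _ 0 f (@dual_continuous f 0).
move=> /pinfty_ex_gt0[M M0 Mf]; exists M => _ [e /= e1 <-].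
by rewrite (le_trans (Mf e))// ler_piMr// ltW.
Qed.

Let norm_ub (f : dual) e : `|e| <= 1 -> `|f e| <= norm f.
Proof.
by move=> e1; apply: ub_le_sup; [exact: (values_sup f).2|exists e].
Qed.

Let norm_le (f : dual) M : (forall e, `|e| <= 1 -> `|f e| <= M) -> norm f <= M.
Proof.
move=> Mf; apply: ge_sup; first exact: (values_sup f).1.
by move=> _ [e e1 <-]; exact: Mf.
Qed.

Let normD (f g : dual) : norm (f + g) <= norm f + norm g.
Proof.
apply: norm_le => e e1.
by rewrite (le_trans (ler_normD _ _))// lerD// norm_ub.
Qed.

Let normZ (a : R) (f : dual) : norm (a *: f) = `|a| * norm f.
Proof.
have le b h : norm (b *: h) <= `|b| * norm h.
  by apply: norm_le => e e1; rewrite /= normrM ler_wpM2l// norm_ub.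
apply/eqP; rewrite eq_le le/=; have [->|a0] := eqVneq a 0.
  by rewrite normr0 mul0r (le_trans (normr_ge0 ((0 *: f) 0)))// norm_ub// normr0.
rewrite -{1}[f](scalerK a0) -ler_pdivlMl ?normr_gt0//.
by rewrite -normfV le.
Qed.

Let norm_eq0 (f : dual) : norm f = 0 -> f = 0.
Proof.
move=> f0; apply/val_inj/funext => e /=.
have [->|e0] := eqVneq e 0; first by rewrite linear0.
have : `|f (`|e|^-1 *: e)| <= 0.
  rewrite -f0 norm_ub// normrZ normfV normr_id mulVf// normr_eq0//.
rewrite normr_le0 linearZ/= mulf_eq0 invr_eq0 normr_eq0 (negbTE e0)/=.
by move/eqP.
Qed.

HB.instance Definition _ := Lmodule_isNormed.Build R dual normD normZ norm_eq0.

Lemma dual_normE (f : dual) :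
  `|f| = sup [set `|f e| | e in [set e : E | `|e| <= 1]].
Proof. by []. Qed.

Lemma ler_dual_norm (f : dual) (e : E) : `|f e| <= `|f| * `|e|.
Proof.
have [->|e0] := eqVneq e 0; first by rewrite linear0 !normr0 mulr0.
rewrite -ler_pdivrMr ?normr_gt0// mulrC.
have -> : `|e|^-1 * `|f e| = `|f (`|e|^-1 *: e)|.
  by rewrite linearZ/= normrM normfV normr_id.
by apply: norm_ub; rewrite normrZ normfV normr_id mulVf// normr_eq0.
Qed.

End dual.

Section lip0.
Context {R : realType} {X : metricType R} (o : X) (F : normedModType R).

(* The base point [o] is an explicit parameter: the metric structure alone does
   not determine it. *)
Definition lip_constants (f : X -> F) : set R :=
  [set k | 0 <= k /\ forall x y, `|f x - f y| <= k * mdist x y].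

Definition is_lip0 : {pred X -> F} :=
  fun f => `[< lip_constants f !=set0 /\ f o = 0 >].

Lemma lip_constantsZD (a : R) f g k l : lip_constants f k -> lip_constants g l ->
  lip_constants (a *: f + g) (`|a| * k + l).
Proof.
move=> [k0 fk] [l0 gl]; split=> [|x y]; first by rewrite addr_ge0// mulr_ge0.
rewrite !fctE opprD addrACA -scalerBr (le_trans (ler_normD _ _))//.
by rewrite mulrDl lerD// normrZ -mulrA ler_wpM2l.
Qed.

Fact is_lip0_submod : submod_closed is_lip0.
Proof.
split=> [|a f g].
  apply/asboolP; split=> //; exists 0; split=> // x y.
  by rewrite subrr normr0 mul0r.
move=> /asboolP[[k fk] f0] /asboolP[[l gl] g0]; apply/asboolP; split.
  by exists (`|a| * k + l); exact: lip_constantsZD.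
by rewrite !fctE f0 g0 scaler0 addr0.
Qed.

HB.instance Definition _ := GRing.isSubmodClosed.Build R (X -> F)
  is_lip0 is_lip0_submod.

Record lip0 := Lip0 {
  lip0_fun :> X -> F ;
  _ : lip0_fun \in is_lip0 }.

HB.instance Definition _ := [isSub for lip0_fun].
HB.instance Definition _ := [Choice of lip0 by <:].
HB.instance Definition _ := [SubChoice_isSubLmodule of lip0 by <:].

Lemma lip0_base (f : lip0) : f o = 0.
Proof. by case: f => f /= /asboolP[]. Qed.

Let norm (f : lip0) : R := inf (lip_constants f).

Let has_const (f : lip0) : lip_constants f !=set0.
Proof. by case: f => f /= /asboolP[]. Qed.

Let norm_le (f : lip0) k : lip_constants f k -> norm f <= k.
Proof. by move=> fk; apply: ge_inf => //; exists 0 => l []. Qed.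

Let norm_const (f : lip0) : lip_constants f (norm f).
Proof.
split=> [|x y]; first by apply: lb_le_inf => // k [].
have [->|xy] := eqVneq x y; first by rewrite subrr normr0 mdistxx mulr0.
rewrite -ler_pdivrMr ?mdist_gt0//; apply: lb_le_inf => // k [k0 fk].
by rewrite ler_pdivrMr ?mdist_gt0.
Qed.

Let normD (f g : lip0) : norm (f + g) <= norm f + norm g.
Proof.
apply: norm_le; have := lip_constantsZD 1 (norm_const f) (norm_const g).
by rewrite normr1 mul1r scale1r.
Qed.

Let normZ (a : R) (f : lip0) : norm (a *: f) = `|a| * norm f.
Proof.
have le b h : norm (b *: h) <= `|b| * norm h.
  apply: norm_le; have [h0 hk] := norm_const h; split; first exact: mulr_ge0.
  by move=> x y /=; rewrite -scalerBr normrZ -mulrA ler_wpM2l.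
apply/eqP; rewrite eq_le le/=; have [->|a0] := eqVneq a 0.
  by rewrite normr0 mul0r; have [] := norm_const (0 *: f).
rewrite -{1}[f](scalerK a0) -ler_pdivlMl ?normr_gt0//.
by rewrite -normfV le.
Qed.

Let norm_eq0 (f : lip0) : norm f = 0 -> f = 0.
Proof.
move=> f0; apply/val_inj/funext => x /=; have [_ /(_ x o)] := norm_const f.
by rewrite f0 mul0r lip0_base subr0 normr_le0 => /eqP.
Qed.

HB.instance Definition _ := Lmodule_isNormed.Build R lip0 normD normZ norm_eq0.

Lemma lip0_normE (f : lip0) : `|f| = inf (lip_constants f).
Proof. by []. Qed.

Lemma lip0_norm_least (f : lip0) :
  lip_constants f `|f| /\ forall k, lip_constants f k -> `|f| <= k.
Proof. by split; [exact: norm_const|exact: norm_le]. Qed.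

End lip0.

Definition lin_span {R : realType} {V : lmodType R} (A : set V) : {pred V} :=
  fun v => `[< exists s : seq (R * V),
    (forall p, p \in s -> A p.2) /\ v = \sum_(p <- s) p.1 *: p.2 >].

Fact lin_span_submod {R : realType} {V : lmodType R} (A : set V) :
  submod_closed (lin_span A).
Proof.
split=> [|a u v].
  by apply/asboolP; exists [::]; split=> //; rewrite big_nil.
move=> /asboolP[s [sA ->]] /asboolP[t [tA ->]]; apply/asboolP.
exists ([seq (a * p.1, p.2) | p <- s] ++ t); split.
  move=> p; rewrite mem_cat => /orP[/mapP[q qs ->]/=|/tA//]; exact: sA.
rewrite big_cat big_map scaler_sumr; congr (_ + _).
by apply: eq_bigr => p _; rewrite scalerA.
Qed.

HB.instance Definition _ (R : realType) (V : lmodType R) (A : set V) :=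
  GRing.isSubmodClosed.Build R V (lin_span A) (lin_span_submod A).

Section lipschitz_tensor.
Context {R : realType} {X : metricType R} (o : X) (E : normedModType R).
Local Notation LipE := (lip0 o (dual E)).

(* [box x y e] is the functional delta_(x,y) [x] e : f |-> <f x - f y, e>. *)
Definition box_fun (x y : X) (e : E) : LipE -> R := fun f => (f x - f y) e.

Fact box_fun_linear x y e : box_fun x y e \in is_linear_functional (V := LipE).
Proof.
apply/asboolP => a f g; rewrite /box_fun /= scalerBr opprD.
by rewrite addrACA.
Qed.

Definition box (x y : X) (e : E) : algdual LipE := AlgDual (box_fun_linear x y e).

Definition is_lip_tensor : {pred algdual LipE} :=
  lin_span [set box p.1.1 p.1.2 p.2 | p in [set: X * X * E]].

HB.instance Definition _ := GRing.SubmodClosed.on is_lip_tensor.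

Record lip_tensor := LipTensor {
  lip_tensor_val :> algdual LipE ;
  _ : lip_tensor_val \in is_lip_tensor }.

HB.instance Definition _ := [isSub for lip_tensor_val].
HB.instance Definition _ := [Choice of lip_tensor by <:].
HB.instance Definition _ := [SubChoice_isSubLmodule of lip_tensor by <:].

Fact box_lip_tensor x y e : box x y e \in is_lip_tensor.
Proof.
apply/asboolP; exists [:: (1, box x y e)]; split.
  by move=> p; rewrite inE => /eqP ->; exists (x, y, e).
by rewrite big_seq1 scale1r.
Qed.

Definition lbox (x y : X) (e : E) : lip_tensor := LipTensor (box_lip_tensor x y e).

Definition lbox_sum (s : seq (X * X * E)) : lip_tensor :=
  \sum_(p <- s) lbox p.1.1 p.1.2 p.2.

Lemma lbox_sumE s (f : LipE) :
  lbox_sum s f = \sum_(p <- s) (f p.1.1 - f p.1.2) p.2.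
Proof.
by rewrite /lbox_sum; elim: s => [|p s ih]; rewrite ?big_nil// !big_cons -ih.
Qed.

Lemma lboxZ a x y e : a *: lbox x y e = lbox x y (a *: e).
Proof.
by do 2![apply/val_inj => /=]; apply/funext => f; rewrite /box_fun dualZ.
Qed.

Lemma lip_tensor_repr_subproof (u : lip_tensor) : exists s, u = lbox_sum s.
Proof.
case: u => v uv; have /asboolP[t [tA vE]] := uv.
suff [s sE] : exists s, v = val (lbox_sum s) by exists s; exact/val_inj.
rewrite {uv}vE; elim: t tA => [|[a w] t ih] tA.
  by exists [::]; rewrite /lbox_sum !big_nil.
have [|s sE] := ih; first by move=> p pt; apply: tA; rewrite inE pt orbT.
have [|[[x y] e] _ /= wE] := tA (a, w); first by rewrite inE eqxx.
exists ((x, y, a *: e) :: s); rewrite /lbox_sum !big_cons sE /=.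
by have /= <- := congr1 val (lboxZ a x y e); rewrite wE.
Qed.

Definition lip_tensor_repr (u : lip_tensor) : seq (X * X * E) :=
  projT1 (cid (lip_tensor_repr_subproof u)).

Lemma lip_tensor_reprK u : lbox_sum (lip_tensor_repr u) = u.
Proof. by rewrite /lip_tensor_repr; case: cid. Qed.

Definition eps_sum (s : seq (X * X * E)) (g : lip0 o R) (phi : dual E) : R :=
  \sum_(p <- s) (g p.1.1 - g p.1.2) * phi p.2.

Definition eps_repr (s : seq (X * X * E)) : R :=
  sup [set r | exists (g : lip0 o R) (phi : dual E),
    [/\ `|g| <= 1, `|phi| <= 1 & r = `|eps_sum s g phi| ]].

(* Computed on a chosen representation; [epsE] shows that any other
   representation gives the same value. *)
Definition eps (u : lip_tensor) : R := eps_repr (lip_tensor_repr u).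

Let rank1_fun (g : lip0 o R) (phi : dual E) : X -> dual E :=
  fun x => (g x : R) *: phi.

Let rank1_lip0 g phi : rank1_fun g phi \in is_lip0 o (F := dual E).
Proof.
apply/asboolP; split; last by rewrite /rank1_fun lip0_base scale0r.
exists (`|g| * `|phi|); split; first exact: mulr_ge0.
move=> x y; rewrite /rank1_fun -scalerBl normrZ mulrAC ler_wpM2r//.
by have [[_ ->]] := lip0_norm_least g.
Qed.

Let rank1 g phi : LipE := Lip0 (rank1_lip0 g phi).

Let eps_sumE s g phi : eps_sum s g phi = lbox_sum s (rank1 g phi).
Proof.
rewrite lbox_sumE; apply: eq_bigr => p _ /=.
by rewrite /rank1_fun -scalerBl.
Qed.

Lemma epsE s : eps (lbox_sum s) = eps_repr s.
Proof.
rewrite /eps /eps_repr; congr (sup _); apply/seteqP.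
by split => r [g [phi [g1 phi1 ->]]]; exists g, phi; split=> //;
  rewrite !eps_sumE lip_tensor_reprK.
Qed.

Let values (u : lip_tensor) : set R :=
  [set r | exists (g : lip0 o R) (phi : dual E),
    [/\ `|g| <= 1, `|phi| <= 1 & r = `|u (rank1 g phi)| ]].

Let eps_values u : eps u = sup (values u).
Proof.
rewrite /eps /eps_repr; congr (sup _); apply/seteqP.
by split => r [g [phi [g1 phi1 ->]]]; exists g, phi; split=> //;
  rewrite !eps_sumE lip_tensor_reprK.
Qed.

Let values_sup u : has_sup (values u).
Proof.
split; first by exists `|u (rank1 0 0)|, 0, 0; rewrite !normr0.
exists (\sum_(p <- lip_tensor_repr u) mdist p.1.1 p.1.2 * `|p.2|).
move=> _ [g [phi [g1 phi1 ->]]]; rewrite -{1}[u]lip_tensor_reprK -eps_sumE.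
rewrite (le_trans (ler_norm_sum _ _ _))// ler_sum// => p _.
rewrite normrM ler_pM//.
  have [[_ gk] _] := lip0_norm_least g.
  by rewrite (le_trans (gk _ _))// ler_piMl// mdist_ge0.
by rewrite (le_trans (ler_dual_norm _ _))// ler_piMl.
Qed.

Let eps_ub (u : lip_tensor) (g : lip0 o R) (phi : dual E) :
  `|g| <= 1 -> `|phi| <= 1 -> `|u (rank1 g phi)| <= eps u.
Proof.
move=> g1 phi1; rewrite eps_values; apply: ub_le_sup.
  exact: (values_sup u).2.
by exists g, phi.
Qed.

Let eps_le (u : lip_tensor) M :
  (forall (g : lip0 o R) (phi : dual E),
    `|g| <= 1 -> `|phi| <= 1 -> `|u (rank1 g phi)| <= M) ->
  eps u <= M.
Proof.
move=> uM; rewrite eps_values; apply: ge_sup; first exact: (values_sup u).1.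
by move=> _ [g [phi [g1 phi1 ->]]]; exact: uM.
Qed.

Let epsD u v : eps (u + v) <= eps u + eps v.
Proof.
apply: eps_le => g phi g1 phi1.
by rewrite (le_trans (ler_normD _ _))// lerD// eps_ub.
Qed.

Let epsZ (a : R) u : eps (a *: u) = `|a| * eps u.
Proof.
have le b v : eps (b *: v) <= `|b| * eps v.
  by apply: eps_le => g phi g1 phi1; rewrite /= normrM ler_wpM2l// eps_ub.
apply/eqP; rewrite eq_le le/=; have [->|a0] := eqVneq a 0.
  rewrite normr0 mul0r (le_trans (normr_ge0 ((0 *: u) (rank1 0 0))))//.
  by rewrite eps_ub// normr0.
rewrite -{1}[u](scalerK a0) -ler_pdivlMl ?normr_gt0//.
by rewrite -normfV le.
Qed.

Let min_dist (s : seq R) : exists2 r : R, 0 < r & {in s, forall x, 0 < x -> r <= x}.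
Proof.
elim: s => [|x s [r r0 rs]]; first by exists 1.
have [x0|x0] := ltP 0 x; last first.
  exists r => // y; rewrite inE => /predU1P[->|/rs//].
  by rewrite ltNge x0.
exists (Num.min x r) => [|y]; first by rewrite lt_min x0.
by rewrite inE ge_min => /predU1P[->|/rs ry /ry ->]; rewrite ?lexx ?orbT.
Qed.

Section bump.
Variables (p : X) (r : R).
Hypothesis r_far : r <= mdist p o.

Let bump_fun (x : X) : R := Num.max 0 (r - mdist p x).

Let bump_const : lip_constants bump_fun 1.
Proof.
split=> // x y; rewrite mul1r /bump_fun.
have tri (a b : X) : mdist p a <= mdist p b + mdist b a.
  exact: metric_triangle.
have := tri x y; have := tri y x; rewrite (metric_sym y x).
have d0 := mdist_ge0 x y.
rewrite ler_norml.
case: (leP 0 (r - mdist p x)); case: (leP 0 (r - mdist p y)); lra.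
Qed.

Let bump_lip0 : bump_fun \in is_lip0 o (F := R).
Proof.
apply/asboolP; split; first by exists 1.
by rewrite /bump_fun max_l// subr_le0.
Qed.

Definition bump : lip0 o R := Lip0 bump_lip0.

Lemma bump_norm : `|bump| <= 1.
Proof. by have [_] := lip0_norm_least bump; apply. Qed.

Lemma bump_far x : r <= mdist p x -> bump x = 0.
Proof. by move=> rx; rewrite /= /bump_fun max_l// subr_le0. Qed.

Lemma bump_self : 0 <= r -> bump p = r.
Proof. by move=> r0; rewrite /= /bump_fun mdistxx subr0 max_r. Qed.
End bump.

(* On the finitely many points involved in [u], every [f : LipE] is a
   combination of rank-one maps [rank1 (bump q) (f q)], so no separation
   theorem for [E] is needed. *)
Let eps_eq0 u : eps u = 0 -> u = 0.
Proof.
move=> u0.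
have rank0 (g : lip0 o R) phi : `|g| <= 1 -> u (rank1 g phi) = 0.
  move=> g1; pose a : R := `|phi| + 1; have a0 : 0 < a by rewrite ltr_wpDl.
  apply/eqP; have : `|u (rank1 g (a^-1 *: phi))| <= 0.
    rewrite -u0 eps_ub// normrZ gtr0_norm ?invr_gt0//.
    by rewrite mulrC ler_pdivrMr// mul1r lerDl.
  have uE psi : u (rank1 g psi) = eps_sum (lip_tensor_repr u) g psi.
    by rewrite eps_sumE lip_tensor_reprK.
  rewrite normr_le0 !uE /eps_sum; under eq_bigr do rewrite /= mulrCA.
  by rewrite -mulr_sumr mulf_eq0 invr_eq0 gt_eqF.
apply/val_inj/val_inj/funext => f.
rewrite -[u]lip_tensor_reprK; apply: etrans (lbox_sumE _ _) _ => /=.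
set s := lip_tensor_repr u.
pose S := o :: ([seq q.1.1 | q <- s] ++ [seq q.1.2 | q <- s]).
pose P := undup [seq q <- S | q != o].
have [r r0 rS] := min_dist [seq mdist q.1 q.2 | q <- allpairs pair S S].
have far q z : q \in S -> z \in S -> q != z -> r <= mdist q z.
  move=> qS zS qz; apply: rS; last by rewrite mdist_gt0.
  by apply/mapP; exists (q, z) => //; apply/allpairsP; exists (q, z).
have PS q : q \in P -> q \in S /\ q != o.
  by rewrite mem_undup mem_filter => /andP[].
have oS : o \in S by rewrite inE eqxx.
have farP q : q \in P -> r <= mdist q o by move=> /PS[qS qo]; exact: far.
pose b q : lip0 o R :=
  if pselect (r <= mdist q o) is left h then bump h else 0.
have bE q z : q \in P -> z \in S -> b q z = if q == z then r else 0.
  move=> qP zS; rewrite /b; case: pselect => [h|/(_ (farP _ qP))//].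
  have [<-|qz] := eqVneq q z; first by rewrite bump_self// ltW.
  by rewrite bump_far// far//; have [] := PS _ qP.
have b1 q : `|b q| <= 1.
  by rewrite /b; case: pselect => [h|_]; rewrite ?normr0// bump_norm.
have fE z e : z \in S -> f z e = r^-1 * \sum_(q <- P) b q z * f q e.
  move=> zS; have [->|zo] := eqVneq z o.
    rewrite lip0_base big1 ?mulr0// => q _.
    by rewrite lip0_base mul0r.
  have zP : z \in P by rewrite mem_undup mem_filter zo.
  rewrite (bigD1_seq z) ?undup_uniq//= bE// eqxx big1_seq ?addr0.
    by rewrite mulrA mulVf ?mul1r// gt_eqF.
  by move=> q /andP[qz qP]; rewrite bE// (negbTE qz) mul0r.
transitivity (r^-1 * \sum_(q <- P) eps_sum s (b q) (f q)); last first.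
  rewrite big1 ?mulr0// => q _.
  by rewrite eps_sumE lip_tensor_reprK rank0.
rewrite /eps_sum exchange_big /= mulr_sumr; apply: eq_big_seq => t ts.
have [t1 t2] : t.1.1 \in S /\ t.1.2 \in S.
  by split; rewrite inE mem_cat; apply/orP; right; apply/orP;
    [left|right]; apply/mapP; exists t.
transitivity (f t.1.1 t.2 - f t.1.2 t.2); first by [].
rewrite !fE// -mulrBr -sumrB; congr (_ * _); apply: eq_bigr => q _.
by rewrite mulrBl.
Qed.

HB.instance Definition _ :=
  Lmodule_isNormed.Build R lip_tensor epsD epsZ eps_eq0.

Lemma lip_tensor_normE (u : lip_tensor) : `|u| = eps u.
Proof. by []. Qed.

End lipschitz_tensor.

Arguments lbox {R X} o {E}.

(* A completion is determined only up to isometric isomorphism, so it is a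
   complete space together with the embedding of [V]. *)
Definition is_completion {R : realType} (V : normedModType R)
    (C : completeNormedModType R) (i : {linear V -> C}) : Prop :=
  (forall v, `|i v| = `|v|) /\ dense (range i).

(* Main.v *)
Require Import Defs.
From HB Require Import structures.
From mathcomp Require Import all_boot all_order all_algebra.
From mathcomp Require Import all_classical all_reals.
From mathcomp Require Import topology normedtype.
From mathcomp Require Import lra.

(** The Lipschitz injective norm of a sum of elementary tensors is a supremum
of bilinear sums over pairs consisting of a Lipschitz function and a functional,
both taken from unit balls. The norm is injective because both unit balls
restrict onto the unit balls of the subobjects. Restriction to a subspace never
increases a norm; conversely a real Lipschitz function on [X0] extends to [X]
with the same constant ([mcshane_extension]), and a continuous functional on
[E0] extends to [E] with the same norm ([dual_extension], from [hahn_banach]).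
Hence the two suprema defining the norm of a sum over [X0] and [E0], and of the
same sum read over [X] and [E], range over the same set of reals
([eps_repr_incl]).

This equality of norms also makes the inclusion of tensors well defined: two
sums representing the same tensor over [X0] and [E0] differ by a sum of norm
zero, whose image has norm zero as well. So there is a linear isometry of
uncompleted tensor products ([tensor_inclusion]). Composed with the embedding
into the larger completion, it is an isometry into a complete space, and it
extends by density to the smaller completion
([completion_isometric_extension]). *)

Set Implicit Arguments.
Unset Strict Implicit.
Unset Printing Implicit Defensive.

Import Order.TTheory GRing.Theory Num.Theory.
Import numFieldNormedType.Exports.

Local Open Scope classical_set_scope.
Local Open Scope ring_scope.

(** * The Hahn-Banach theorem *)

Section hahn_banach.
Context {R : realType} {V : lmodType R} (p : V -> R).
Hypothesis pD : forall u v, p (u + v) <= p u + p v.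
Hypothesis pZ : forall a v, 0 <= a -> p (a *: v) = a * p v.

(** Partial linear functionals below [p] are handled as graphs, so that a chain
of them has its plain union as upper bound. Single-valuedness is left out of the
definition since it follows from domination: see [dominated_graph_inj]. *)
Definition dominated_graph (G : set (V * R)) : Prop :=
  [/\ G (0, 0),
      forall a u v, G u -> G v -> G (a *: u.1 + v.1, a * u.2 + v.2) &
      forall u, G u -> u.2 <= p u.1].

Lemma dominated_graphZ G a u : dominated_graph G -> G u -> G (a *: u.1, a * u.2).
Proof. by move=> [G0 GD _] /(GD a)/(_ G0); rewrite !addr0. Qed.

(** The difference of two values at the same point is a value at [0], hence at
most [p 0 = 0]; by symmetry it vanishes. *)
Lemma dominated_graph_inj G v s t :
  dominated_graph G -> G (v, s) -> G (v, t) -> s = t.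
Proof.
move=> [_ GD Gp].
suff le a b : G (v, a) -> G (v, b) -> b <= a.
  by move=> Gs Gt; apply/eqP; rewrite eq_le !le.
move=> Ga Gb; have /Gp /= := GD (-1) _ _ Ga Gb.
by rewrite scaleN1r addNr -(scale0r v) pZ// mul0r mulN1r addrC subr_le0.
Qed.

(** The value [c] at the new point [x] has to satisfy
[u.2 - p (u.1 - x) <= c <= p (v.1 + x) - v.2] for all [u] and [v] in the graph.
Subadditivity puts every left-hand side below every right-hand side, so the
supremum of the former will do; homogeneity reduces all multiples of [x] to
these two conditions. *)
Lemma dominated_graph_step G x : dominated_graph G ->
  exists2 H, dominated_graph H & G `<=` H /\ exists c, H (x, c).
Proof.
move=> gG; have [G0 GD Gp] := gG.
pose lower := [set u.2 - p (u.1 - x) | u in G].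
have lower_le v : G v -> ubound lower (p (v.1 + x) - v.2).
  move=> Gv _ [u Gu <-]; have /Gp /= := GD 1 _ _ Gu Gv.
  rewrite scale1r mul1r => uv; have := pD (u.1 - x) (v.1 + x).
  by rewrite addrACA addNr addr0; lra.
have lower0 : lower !=set0 by exists (0 - p (0 - x)), (0, 0).
pose c := sup lower.
have cle v : G v -> v.2 + c <= p (v.1 + x).
  by move=> Gv; rewrite addrC -lerBrDr; apply: ge_sup => //; exact: lower_le.
have cge u : G u -> u.2 - c <= p (u.1 - x).
  move=> Gu; rewrite lerBlDr -lerBlDl; apply: ub_le_sup; last by exists u.
  by exists (p (0 + x) - 0); exact: (lower_le (0, 0)).
exists [set w | exists a, exists2 u, G u & w = (u.1 + a *: x, u.2 + a * c)].
  split.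
  - by exists 0, (0, 0) => //; rewrite scale0r mul0r !addr0.
  - move=> a _ _ [b [u Gu ->]] [d [v Gv ->]] /=.
    exists (a * b + d), (a *: u.1 + v.1, a * u.2 + v.2); first exact: GD.
    rewrite /= scalerDr scalerA scalerDl addrACA; congr (_, _).
    by rewrite mulrDr mulrDl mulrA addrACA.
  - move=> _ [a [u Gu ->]] /=; case: (ltgtP a 0) => [a0|a0|->].
    + have Na0 : 0 < - a by rewrite oppr_gt0.
      have := cge _ (dominated_graphZ (- a)^-1 gG Gu).
      move=> /(ler_wpM2l (ltW Na0)); rewrite -(pZ _ (ltW Na0))/= mulrBr.
      rewrite mulVKf ?gt_eqF// scalerBr scalerA divff ?gt_eqF// scale1r.
      by rewrite scaleNr opprK mulNr opprK.
    + have := cle _ (dominated_graphZ a^-1 gG Gu).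
      move=> /(ler_wpM2l (ltW a0)); rewrite -(pZ _ (ltW a0))/= mulrDr.
      by rewrite mulVKf ?gt_eqF// scalerDr scalerA divff ?gt_eqF// scale1r.
    + by rewrite scale0r mul0r !addr0; exact: Gp.
split=> [u Gu|].
  by exists 0, u => //; rewrite scale0r mul0r !addr0; case: u Gu.
by exists c, 1, (0, 0) => //; rewrite scale1r mul1r !add0r.
Qed.

Theorem hahn_banach G : dominated_graph G ->
  exists2 f : V -> R, linear f &
    (forall v, f v <= p v) /\ (forall u, G u -> f u.1 = u.2).
Proof.
move=> gG.
(* Zorn's lemma is applied to the sets [A] such that [G `|` A] is a dominated
   graph rather than to the graphs that contain [G]: the union of the empty chain
   is empty, and must satisfy the predicate. *)
have [|A [gA Amax]] :=
    @Zorn_bigcup _ (fun A => dominated_graph (G `|` A)).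
  move=> F FP Ftot.
  have pair u v : (G `|` \bigcup_(X in F) X) u ->
      (G `|` \bigcup_(X in F) X) v ->
      exists Z, [/\ dominated_graph (G `|` Z), Z `<=` \bigcup_(X in F) X,
                    (G `|` Z) u & (G `|` Z) v].
    move=> [Gu|[Y FY Yu]] [Gv|[Z FZ Zv]].
    + by exists set0; rewrite setU0; split.
    + by exists Z; split; [exact: FP|exact: bigcup_sup|left|right].
    + by exists Y; split; [exact: FP|exact: bigcup_sup|right|left].
    + have [YZ|ZY] := Ftot _ _ FY FZ.
      * exists Z; split; [exact: FP|exact: bigcup_sup| |by right].
        by right; exact: YZ.
      * exists Y; split; [exact: FP|exact: bigcup_sup|by right|].
        by right; exact: ZY.
  split=> [|a u v Bu Bv|u Bu]; first by left; case: gG.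
    by have [Z [[_ ZD _] ZF Zu Zv]] := pair _ _ Bu Bv;
      have [|/ZF] := ZD a _ _ Zu Zv; [left|right].
  by have [Z [[_ _ Zp] _ Zu _]] := pair _ _ Bu Bu; exact: Zp.
set H := G `|` A in gA; have [H0 HD Hp] := gA.
have total x : exists c, H (x, c).
  have [K gK [HK [c Kc]]] := dominated_graph_step x gA.
  exists c; apply: contrapT => nHc; apply: (Amax K).
    split=> [u Au|KA]; first by apply: HK; right.
    by apply: nHc; right; exact: KA.
  by rewrite (_ : G `|` K = K)//; apply/setUidPr => u Gu; apply: HK; left.
pose f x := projT1 (cid (total x)).
have fH x : H (x, f x) by rewrite /f; case: cid.
exists f.
  move=> a u v; apply: (dominated_graph_inj gA (fH _)).
  exact: HD (fH u) (fH v).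
split=> [v|[v t] Gv]; first exact: Hp (fH v).
by apply: (dominated_graph_inj gA (fH _)); left.
Qed.

End hahn_banach.

(** * Extension and restriction of continuous functionals *)

Section dual_extension.
Context {R : realType} {E : normedModType R}.

Lemma dual_of_bounded (f : E -> R) (k : R) : 0 <= k -> linear f ->
  (forall e, f e <= k * `|e|) ->
  exists2 phi : dual E, phi =1 f & `|phi| <= k.
Proof.
move=> k0 flin fk; pose F : {linear E -> R} :=
  HB.pack f (GRing.isLinear.Build R E R _ f flin).
have fN e : `|f e| <= k * `|e|.
  rewrite ler_norml fk andbT lerNl -normrN.
  by have := fk (- e); rewrite -[f (- e)]/(F (- e)) linearN.
have fc : continuous f.
  apply: (@bounded_linear_continuous _ _ _ F); apply/linear_boundedP.
  near=> r => x; rewrite (le_trans (fN x))// ler_wpM2r//.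
  by near: r; apply: nbhs_pinfty_ge; rewrite num_real.
have fP : f \in is_continuous_functional (E := E) by apply/asboolP.
exists (Dual fP) => //; rewrite dual_normE; apply: ge_sup.
  by exists `|f 0|, 0; rewrite //= normr0.
move=> _ [e e1 <-] /=; rewrite (le_trans (fN e))//.
by rewrite -[leRHS]mulr1 ler_wpM2l.
Unshelve. all: by end_near. Qed.

End dual_extension.

Lemma dual_restriction {R : realType} {E : normedModType R}
    (S : submodClosed E) (phi : dual E) :
  exists2 phi0 : dual (linear_subspace S),
    (forall e, phi0 e = phi (val e)) & `|phi0| <= `|phi|.
Proof.
have [|||phi0 phi0E phi0_le] :=
    @dual_of_bounded R (linear_subspace S) (fun e => phi (val e)) `|phi|.
- by [].
- by move=> a u v /=; rewrite linearP.
- by move=> e; rewrite (le_trans (ler_norm _))// ler_dual_norm.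
by exists phi0.
Qed.

(** Hahn-Banach for the sublinear function [fun v => `|phi0| * `|v|]. *)
Lemma dual_extension {R : realType} {E : normedModType R}
    (S : submodClosed E) (phi0 : dual (linear_subspace S)) :
  exists2 phi : dual E,
    (forall e : linear_subspace S, phi (val e) = phi0 e) & `|phi| <= `|phi0|.
Proof.
pose p (v : E) := `|phi0| * `|v|.
pose G := [set (val e, phi0 e) | e in [set: linear_subspace S]].
have [|||f flin [fp fG]] := @hahn_banach R E p _ _ G.
- by move=> u v; rewrite /p -mulrDr ler_wpM2l// ler_normD.
- by move=> a v a0; rewrite /p normrZ ger0_norm// mulrCA.
- split.
  + by exists 0 => //=; rewrite linear0.
  + move=> a _ _ [u _ <-] [v _ <-] /=; exists (a *: u + v) => //.
    by congr (_, _); exact: linearP.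
  + move=> _ [e _ <-] /=.
    by rewrite (le_trans (ler_norm _))// ler_dual_norm.
have [//|//|//|phi phiE phi_le] := @dual_of_bounded R E f `|phi0|.
by exists phi => // e; rewrite phiE (fG (val e, phi0 e))//; exists e.
Qed.

(** * Extension and restriction of Lipschitz functions *)

Lemma lip0_of_constant {R : realType} {X : metricType R} (o : X)
    {F : normedModType R} (f : X -> F) (k : R) :
  lip_constants f k -> f o = 0 -> exists2 g : lip0 o F, g =1 f & `|g| <= k.
Proof.
move=> fk f0; have fP : f \in is_lip0 o (F := F).
  by apply/asboolP; split=> //; exists k.
by exists (Lip0 fP) => //; apply: (lip0_norm_least (Lip0 fP)).2.
Qed.

Section lip0_extension.
Context {R : realType} {X : metricType R} {o : X} {X0 : set X} (oX0 : X0 o).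

Lemma lip0_restriction (F : normedModType R) (g : lip0 o F) :
  exists2 g0 : lip0 (restricted_point oX0) F,
    (forall x, g0 x = g (val x)) & `|g0| <= `|g|.
Proof.
apply: (@lip0_of_constant _ _ _ _ (fun x : X0 => g (val x))).
  have [[g0 gk] _] := lip0_norm_least g.
  by split=> // x y; exact: gk.
exact: (lip0_base g).
Qed.

(** The extension is the infimal convolution
[fun x => inf_(y in X0) (g0 y + k * mdist y x)], with [k] the norm of [g0]. Each
function in the infimum is [k]-Lipschitz, hence so is the infimum when it is
finite; it agrees with [g0] on [X0] because the Lipschitz condition for [g0] says
that the infimum is attained at [y = x]. *)
Theorem mcshane_extension (g0 : lip0 (restricted_point oX0) R) :
  exists2 g : lip0 o R, (forall x : X0, g (val x) = g0 x) & `|g| <= `|g0|.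
Proof.
set k := `|g0|; have [[k0 gk] _] := lip0_norm_least g0.
pose cone x := [set g0 y + k * mdist (val y) x | y in [set: X0]].
pose f x := inf (cone x).
have g0k (x y : X0) : g0 x <= g0 y + k * mdist (val y) (val x).
  rewrite -lerBlDl (le_trans (ler_norm _))// metric_sym; exact: gk.
have cone0 x : cone x !=set0.
  by exists (g0 (restricted_point oX0) + k * mdist o x), (restricted_point oX0).
have cone_lb x : has_lbound (cone x).
  exists (- (k * mdist o x)) => _ [y _ <-].
  (* [g0 y] is at least [- k * mdist y o], as [g0] vanishes at the base point. *)
  have := g0k (restricted_point oX0) y; rewrite lip0_base /=.
  have : k * mdist (val y) o <= k * mdist (val y) x + k * mdist o x.
    by rewrite -mulrDr ler_wpM2l// [mdist o x]metric_sym metric_triangle.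
  lra.
have f_le x (y : X0) : f x <= g0 y + k * mdist (val y) x.
  by apply: ge_inf; [exact: cone_lb|exists y].
have fE (x : X0) : f (val x) = g0 x.
  apply/eqP; rewrite eq_le; apply/andP; split.
    by rewrite (le_trans (f_le _ x))// mdistxx mulr0 addr0.
  by apply: lb_le_inf => // _ [y _ <-]; exact: g0k.
have flip x y : f x <= f y + k * mdist x y.
  rewrite -lerBlDr; apply: lb_le_inf => // _ [z _ <-].
  rewrite lerBlDr (le_trans (f_le _ z))// -addrA lerD2l -mulrDr ler_wpM2l//.
  by rewrite [mdist x y]metric_sym metric_triangle.
have [||g gf gk'] := @lip0_of_constant _ _ o _ f k.
- split=> // x y; rewrite ler_norml; have := flip x y; have := flip y x.
  rewrite (metric_sym y x); lra.
- by rewrite -(lip0_base g0) -fE.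
by exists g => // x; rewrite gf fE.
Qed.

End lip0_extension.

(** * Inclusion of the uncompleted tensor products *)

Section lbox_sum_combination.
Context {R : realType} {X : metricType R} {E : normedModType R}.

(** A representation of the combination [a *: u + v] of the tensors represented
by [s] and [t]. *)
Definition repr_comb (a : R) (s t : seq (X * X * E)) : seq (X * X * E) :=
  [seq (p.1, a *: p.2) | p <- s] ++ t.

Lemma lbox_sum_comb (o : X) a s t :
  lbox_sum o (repr_comb a s t) = a *: lbox_sum o s + lbox_sum o t.
Proof.
rewrite /lbox_sum big_cat big_map scaler_sumr; congr (_ + _).
by apply: eq_bigr => p _; rewrite lboxZ.
Qed.

End lbox_sum_combination.

Section tensor_inclusion.
Context {R : realType} {X : metricType R} {o : X} {E : normedModType R}.
Context {X0 : set X} (oX0 : X0 o) (E0 : submodClosed E).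
Local Notation o0 := (restricted_point oX0).
Local Notation tensor := (lip_tensor o E).
Local Notation tensor0 := (lip_tensor o0 (linear_subspace E0)).

Definition incl_repr (s : seq (X0 * X0 * linear_subspace E0)) :
    seq (X * X * E) :=
  [seq (val p.1.1, val p.1.2, val p.2) | p <- s].

Lemma eps_sum_incl s (g : lip0 o R) (phi : dual E)
    (g0 : lip0 o0 R) (phi0 : dual (linear_subspace E0)) :
  (forall x : X0, g (val x) = g0 x) ->
  (forall e : linear_subspace E0, phi (val e) = phi0 e) ->
  eps_sum (incl_repr s) g phi = eps_sum s g0 phi0.
Proof.
move=> gE phiE; rewrite /eps_sum big_map; apply: eq_bigr => p _ /=.
by rewrite !gE phiE.
Qed.

(** Both suprema are over the same set: restricting an admissible pair, or
extending one, gives an admissible pair with the same value. *)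
Lemma eps_repr_incl s : eps_repr o (incl_repr s) = eps_repr o0 s.
Proof.
rewrite /eps_repr; congr (sup _); apply/seteqP.
split=> _ [g [phi [g1 phi1 ->]]].
  have [g0 g0E g0_le] := lip0_restriction oX0 g.
  have [phi0 phi0E phi0_le] := dual_restriction E0 phi.
  exists g0, phi0; split; [exact: le_trans g1|exact: le_trans phi1|].
  by rewrite -(@eps_sum_incl _ g phi).
have [g' g'E g'_le] := mcshane_extension g.
have [phi' phi'E phi'_le] := dual_extension phi.
exists g', phi'; split; [exact: le_trans g1|exact: le_trans phi1|].
by rewrite (eps_sum_incl _ g'E phi'E).
Qed.

Lemma norm_lbox_sum_incl s :
  `|lbox_sum o (incl_repr s)| = `|lbox_sum o0 s|.
Proof. by rewrite !lip_tensor_normE !epsE eps_repr_incl. Qed.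

Lemma incl_repr_comb a s t :
  incl_repr (repr_comb a s t) = repr_comb a (incl_repr s) (incl_repr t).
Proof.
by rewrite /incl_repr /repr_comb map_cat -!map_comp; congr (_ ++ _); exact: eq_map.
Qed.

(** The independence of the representation that lets [incl_repr] pass to
tensors. Since [eps] is a norm, it suffices that the difference of the two sums
keeps its norm, which is zero, under inclusion. *)
Lemma lbox_sum_incl s t : lbox_sum o0 s = lbox_sum o0 t ->
  lbox_sum o (incl_repr s) = lbox_sum o (incl_repr t).
Proof.
move=> st; have := norm_lbox_sum_incl (repr_comb (-1) s t).
rewrite incl_repr_comb !lbox_sum_comb st !scaleN1r addNr normr0.
by move=> /normr0_eq0/eqP; rewrite addrC subr_eq0 => /eqP.
Qed.

Theorem tensor_inclusion :
  exists j : {linear tensor0 -> tensor},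
    (forall u, `|j u| = `|u|) /\
    (forall x y e, j (lbox o0 x y e) = lbox o (val x) (val y) (val e)).
Proof.
pose f (u : tensor0) : tensor := lbox_sum o (incl_repr (lip_tensor_repr u)).
have fE s : f (lbox_sum o0 s) = lbox_sum o (incl_repr s).
  by apply: lbox_sum_incl; rewrite lip_tensor_reprK.
have flin : linear f.
  move=> a u v; rewrite -[u in LHS]lip_tensor_reprK -[v in LHS]lip_tensor_reprK.
  by rewrite -lbox_sum_comb fE incl_repr_comb lbox_sum_comb.
pose j : {linear tensor0 -> tensor} :=
  HB.pack f (GRing.isLinear.Build R tensor0 tensor _ f flin).
exists j.
split=> [u|x y e] /=.
  by rewrite /f norm_lbox_sum_incl lip_tensor_reprK.
by have := fE [:: (x, y, e)]; rewrite /lbox_sum !big_seq1.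
Qed.

End tensor_inclusion.

(** * Extension of an isometry to a completion *)

Section completion_extension.
Context {R : realType} {V : normedModType R} {C0 C : completeNormedModType R}.
Context (i0 : {linear V -> C0}) (i0_completion : is_completion i0).
Context (h : {linear V -> C}) (h_isometry : forall v, `|h v| = `|v|).

(** The closure in [C0 * C] of the graph of [h] read through [i0]. Every
property of the extension is proved by approximation on this relation, which
avoids choosing sequences. *)
Definition extension_graph (z : C0) (w : C) : Prop :=
  forall e : R, 0 < e -> exists v, `|i0 v - z| < e /\ `|h v - w| < e.

Lemma completion_approx z (e : R) : 0 < e -> exists v, `|i0 v - z| < e.
Proof.
move=> e0; have [_ /(_ (ball z e))[||y [ye [v _ yE]]]] := i0_completion.
- by exists z; exact: ballxx.
- exact: ball_open.
by exists v; rewrite yE distrC; move: ye; rewrite -ball_normE.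
Qed.

Lemma isometry_dist u v : `|h u - h v| = `|i0 u - i0 v|.
Proof. by rewrite -!linearB h_isometry; have [->] := i0_completion. Qed.

(** The images under [h] of the vectors close to [z] form a Cauchy filter, as
[h] preserves the distances measured in [C0]; its limit is the value sought. *)
Lemma extension_graph_total z : exists w, extension_graph z w.
Proof.
pose B (e : R) := h @` [set v | `|i0 v - z| < e].
pose F := filter_from [set e : R | 0 < e] B.
have FF : ProperFilter F.
  apply: filter_from_proper; last first.
    move=> e /(completion_approx z)[v ve]; exists (h v).
    by exists v.
  apply: filter_from_filter; first by exists 1 => /=.
  move=> d e d0 e0; exists (Num.min d e); first by rewrite /= lt_min d0.
  move=> _ [v + <-]; rewrite /= lt_min => /andP[vd ve].
  by split; exists v.
have Fcauchy : cauchy F.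
  apply: cauchy_exP => e e0; have e20 : 0 < e / 2 by rewrite divr_gt0.
  have [u ue] := completion_approx z e20; exists (h u), (e / 2) => // _ [v ve <-].
  rewrite -ball_normE /= isometry_dist.
  rewrite (le_lt_trans (ler_distD z _ _))// [e]splitr ltrD//.
  by rewrite distrC.
have Fw : F --> lim F by exact: cauchy_cvg.
exists (lim F) => e e0.
have [d d0 dB] : F (ball (lim F) e) by apply: Fw; exact: nbhsx_ballx.
have [|v] := @completion_approx z (Num.min d e); first by rewrite lt_min d0.
rewrite lt_min => /andP[vd ve]; exists v; split=> //.
have : ball (lim F) e (h v) by apply: dB; exists v.
by rewrite -ball_normE /= distrC.
Qed.

Lemma extension_graph_norm z w : extension_graph z w -> `|w| = `|z|.
Proof.
move=> zw; suff le e : 0 < e -> `| `|w| - `|z| | <= e.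
  by apply/eqP; rewrite -subr_eq0 -normr_le0; apply/ler_addgt0Pl => e /le;
     rewrite addr0.
move=> e0; have [|v [vz vw]] := zw (e / 2); first by rewrite divr_gt0.
have iv : `|h v| = `|i0 v| by rewrite h_isometry; have [->] := i0_completion.
have := lerB_dist (h v) w; have := lerB_dist w (h v).
have := lerB_dist (i0 v) z; have := lerB_dist z (i0 v).
rewrite (distrC z) (distrC w) iv ler_norml; lra.
Qed.

Lemma extension_graph_linear a z w z' w' : extension_graph z w ->
  extension_graph z' w' -> extension_graph (a *: z + z') (a *: w + w').
Proof.
move=> zw zw' e e0; have a10 : 0 < `|a| + 1 by rewrite ltr_wpDl.
have d0 : 0 < e / (`|a| + 1) by rewrite divr_gt0.
have [v [vz vw]] := zw _ d0; have [v' [vz' vw']] := zw' _ d0.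
have near (W : normedModType R) (x y x' y' : W) : `|x - y| < e / (`|a| + 1) ->
    `|x' - y'| < e / (`|a| + 1) -> `|a *: x + x' - (a *: y + y')| < e.
  move=> xy xy'; rewrite opprD addrACA -scalerBr.
  rewrite (le_lt_trans (ler_normD _ _))// normrZ.
  rewrite -[ltRHS](divfK (lt0r_neq0 a10)) [ltRHS]mulrC mulrDl mul1r.
  by rewrite ler_ltD// ler_wpM2l// ltW.
by exists (a *: v + v'); split; rewrite linearP; apply: near.
Qed.

(** The relation is linear and preserves norms, so the difference of two values
at [z] is a value at [0] and has norm zero. *)
Lemma extension_graph_fun z w w' :
  extension_graph z w -> extension_graph z w' -> w = w'.
Proof.
move=> zw zw'; have := extension_graph_norm (extension_graph_linear (-1) zw zw').
rewrite !scaleN1r addNr normr0 => /normr0_eq0/eqP.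
by rewrite addrC subr_eq0 => /eqP.
Qed.

Theorem completion_isometric_extension :
  exists J : {linear C0 -> C},
    (forall z, `|J z| = `|z|) /\ (forall v, J (i0 v) = h v).
Proof.
pose f z := projT1 (cid (extension_graph_total z)).
have fP z : extension_graph z (f z) by rewrite /f; case: cid.
have flin : linear f.
  move=> a u v; apply: extension_graph_fun (fP _) _.
  exact: extension_graph_linear.
pose J : {linear C0 -> C} := HB.pack f (GRing.isLinear.Build R C0 C _ f flin).
exists J; split=> [z|v]; first exact: extension_graph_norm.
apply: extension_graph_fun (fP _) _ => e e0.
by exists v; rewrite !subrr !normr0.
Qed.

End completion_extension.

(** * The inclusion of the completed tensor products *)

Theorem theorem5p4 (R : realType) (X : metricType R) (o : X)
  (E : completeNormedModType R)
  (X0 : set X) (oX0 : X0 o)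
  (E0 : submodClosed E) (E0_closed : closed [set e : E | e \in E0])
  (C : completeNormedModType R) (i : {linear lip_tensor o E -> C})
  (i_completion : is_completion i)
  (C0 : completeNormedModType R)
  (i0 : {linear lip_tensor (restricted_point oX0) (linear_subspace E0) -> C0})
  (i0_completion : is_completion i0) :
  exists J : {linear C0 -> C},
    (forall z : C0, `|J z| = `|z|) /\
    (forall (x y : X0) (e : linear_subspace E0),
       J (i0 (lbox (restricted_point oX0) x y e)) = i (lbox o (val x) (val y) (val e))).
Proof.
have [j [j_isometry jE]] := tensor_inclusion oX0 E0.
have ij_isometry u : `|i (j u)| = `|u|.
  by have [-> _] := i_completion; exact: j_isometry.
have [J [J_isometry JE]] :=
  @completion_isometric_extension _ _ _ _ i0 i0_completion (i \o j) ij_isometry.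
by exists J; split=> // x y e; rewrite JE /= jE.
Qed.
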